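(* Let $c\ge 3$ and let $w\in W_c$ be a reduced billiard table word. The number of Seifert circles in the alternating diagram $D$ obtained from $w$ is two more than the number of viable vertically-smoothed crossings of $D$.
   Context: Words. For $c\ge 3$, $W_c$ is the set of reduced billiard table words $w=(+)^{\varepsilon_1}(-)^{\varepsilon_2}(+)^{\varepsilon_3}(-)^{\varepsilon_4}\cdots$ in the alphabet $\{+,-\}$ consisting of exactly $c$ runs of alternating sign, starting with a $+$ run (so the last run is $(+)^{\varepsilon_c}$ for $c$ odd and $(-)^{\varepsilon_c}$ for $c$ even), with $\varepsilon_1=\varepsilon_c=1$, $\varepsilon_i\in\{1,2\}$ for $2\le i\le c-1$, and length $\ell=\sum_{i=1}^c\varepsilon_i\equiv 1\bmod 3$. Alternating diagram $D$ of $w$. Replace each run of $w$, from left to right, by one crossing: $(+)^1\mapsto\sigma_1$, $(+)^2\mapsto\sigma_2^{-1}$, $(-)^1\mapsto\sigma_2^{-1}$, $(-)^2\mapsto\sigma_1$. This gives a 3-strand braid word with $c$ letters, drawn left to right with strands at heights $1,2,3$ (bottom to top); $\sigma_i^{\pm1}$ is a crossing between heights $i$ and $i+1$ whose overstrand has slope $\pm1$. On the left, strand 1 is the left end of a long knot and strands 2, 3 are joined by a cap. On the right, if $c$ is odd, strands 2, 3 are joined and strand 1 is the right end; if $c$ is even, strands 1, 2 are joined and strand 3 is the right end. The result is a long knot diagram $D$ (closed up in the usual way when viewed as a knot diagram; the long component of a smoothing counts as one circle). Orient it from its left end. Smoothing types. A crossing of $D$ is vertically-smoothed if its two strands are both oriented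 upwards or both oriented downwards, and horizontally-smoothed if both are oriented to the left or both to the right. Two crossings are at the same height if they have the same index $i$ in $\sigma_i^{\pm1}$. Crossings are ordered from left to right. A vertically-smoothed crossing is viable if the next vertically-smoothed crossing appears at the same height or if it is the last vertically-smoothed crossing. Seifert circles are the circles obtained by smoothing all crossings of $D$ according to the orientation (Seifert's algorithm). *)

(* Defs.v *)
From mathcomp Require Import all_boot all_fingroup.

Set Implicit Arguments.
Unset Strict Implicit.
Unset Printing Implicit Defensive.

(* Words in the alphabet {+,-}; [true] stands for +, [false] for -. *)
Definition word := seq bool.

(* (s)^e1 (-s)^e2 (s)^e3 ... *)
Fixpoint word_of_runs (s : bool) (eps : seq nat) : word :=
  if eps is e :: eps' then nseq e s ++ word_of_runs (~~ s) eps' else [::].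

Definition billiard_word (c : nat) (w : word) : Prop :=
  exists eps : seq nat,
    [/\ size eps = c,
        nth 0 eps 0 = 1 /\ nth 0 eps c.-1 = 1,
        (forall e, e \in eps -> e = 1 \/ e = 2),
        sumn eps = 1 %[mod 3]
      & w = word_of_runs true eps].

(* The maximal runs of a word, as pairs (sign, length). *)
Fixpoint runs (w : word) : seq (bool * nat) :=
  if w is s :: w' then
    if runs w' is (s', n) :: r then
      if s == s' then (s, n.+1) :: r else [:: (s, 1), (s', n) & r]
    else [:: (s, 1)]
  else [::].

(* A letter sigma_i^{+1} or sigma_i^{-1} of a 3-strand braid word.  The index
   i = 1, 2 is encoded as 0, 1 in 'I_2, and the boolean is [true] for exponent
   +1, that is, when the overstrand has slope +1.  Strand heights 1, 2, 3 are
   encoded as 0, 1, 2 in 'I_3. *)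
Definition letter := ('I_2 * bool)%type.
Definition sigma1 : letter := (ord0, true).
Definition sigma2V : letter := (ord_max, false).

(* (+)^1 and (-)^2 give sigma_1; (+)^2 and (-)^1 give sigma_2^{-1}.  Runs of
   other lengths do not occur in billiard words. *)
Definition crossing_of_run (r : bool * nat) : letter :=
  if r.1 == (r.2 == 1) then sigma1 else sigma2V.

(* A diagram is given by its braid word; the caps and the ends are determined by
   the parity of the number of letters. *)
Definition diagram := seq letter.
Definition alternating_diagram (w : word) : diagram :=
  [seq crossing_of_run r | r <- runs w].

Section Diagram.

Variable D : diagram.
Notation c := (size D).

Definition crossing_index (i : 'I_c) : 'I_2 := (tnth (in_tuple D) i).1.

(* The two heights between which crossing [i] takes place. *)
Definition lower (i : 'I_c) : 'I_3 := lift ord_max (crossing_index i).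
Definition upper (i : 'I_c) : 'I_3 := lift ord0 (crossing_index i).

(* The point (p, h) is where the diagram meets, at height h, the vertical line
   number p; crossing i lies between the lines i and i + 1. *)
Definition point := ('I_c.+1 * 'I_3)%type.
Definition before (i : 'I_c) : 'I_c.+1 := lift ord_max i.
Definition after (i : 'I_c) : 'I_c.+1 := lift ord0 i.

(* The height of the left (resp. right) end of the long knot; the other two
   heights on that side are joined by a cap. *)
Definition left_end : 'I_3 := ord0.
Definition right_end : 'I_3 := if odd c then ord0 else ord_max.
Definition cap1 (e : 'I_3) : 'I_3 := lift e (ord0 : 'I_2).
Definition cap2 (e : 'I_3) : 'I_3 := lift e (ord_max : 'I_2).

(* A state (p, h, d) is the point (p, h) being passed rightwards if d = true and
   leftwards if d = false.  [travel] moves along the diagram to the next point;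
   the right end is joined to the left end by the closing arc. *)
Definition state := (point * bool)%type.
Definition travel (x : state) : state :=
  let: (p, h, d) := x in
  if d then
    match unlift ord_max p with
    | Some i => (after i, tperm (lower i) (upper i) h, true)
    | None => if h == right_end then (ord0, left_end, true)
              else (ord_max, tperm (cap1 right_end) (cap2 right_end) h, false)
    end
  else
    match unlift ord0 p with
    | Some i => (before i, tperm (lower i) (upper i) h, false)
    | None => if h == left_end then (ord_max, right_end, false)
              else (ord0, tperm (cap1 left_end) (cap2 left_end) h, true)
    end.

Definition start : state := (ord0, left_end, true).

(* The direction in which a point is passed when the diagram is followed from
   its left end.  When D is a knot diagram, exactly one of the two holds. *)
Definition rightwards (x : point) : bool := fconnect travel start (x, true).
Definition leftwards (x : point) : bool := fconnect travel start (x, false).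

(* The two strands of a crossing: [a = true] is the strand of slope +1, from
   (i, lower) to (i + 1, upper), and [a = false] the one of slope -1, from
   (i, upper) to (i + 1, lower). *)
Definition strand_left (i : 'I_c) (a : bool) : point :=
  (before i, if a then lower i else upper i).
Definition strand_right (i : 'I_c) (a : bool) : point :=
  (after i, if a then upper i else lower i).

Definition strand_rightwards (i : 'I_c) (a : bool) : bool :=
  rightwards (strand_left i a).
Definition strand_leftwards (i : 'I_c) (a : bool) : bool :=
  leftwards (strand_left i a).
Definition strand_upwards (i : 'I_c) (a : bool) : bool :=
  if a then strand_rightwards i a else strand_leftwards i a.
Definition strand_downwards (i : 'I_c) (a : bool) : bool :=
  if a then strand_leftwards i a else strand_rightwards i a.

Definition vertically_smoothed (i : 'I_c) : bool :=
  (strand_upwards i true && strand_upwards i false)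
  || (strand_downwards i true && strand_downwards i false).

Definition same_height (i j : 'I_c) : bool :=
  crossing_index i == crossing_index j.

Definition next_vertically_smoothed (i j : 'I_c) : bool :=
  [&& vertically_smoothed j, i < j
    & [forall k : 'I_c, (i < k < j) ==> ~~ vertically_smoothed k]].

Definition last_vertically_smoothed (i : 'I_c) : bool :=
  vertically_smoothed i
  && [forall j : 'I_c, vertically_smoothed j ==> (j <= i)].

Definition viable (i : 'I_c) : bool :=
  vertically_smoothed i
  && ([exists j : 'I_c, next_vertically_smoothed i j && same_height i j]
      || last_vertically_smoothed i).

(* The points by which an oriented strand enters and leaves a crossing. *)
Definition entry (i : 'I_c) (a : bool) : point :=
  if strand_rightwards i a then strand_left i a else strand_right i a.
Definition exit (i : 'I_c) (a : bool) : point :=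
  if strand_rightwards i a then strand_right i a else strand_left i a.

(* The arcs left by Seifert's algorithm: at each crossing, the incoming end of
   each strand is joined to the outgoing end of the other one. *)
Definition seifert_arc (x y : point) : bool :=
  [|| [exists i : 'I_c, [exists a : bool,
         (x == entry i a) && (y == exit i (~~ a))]],
      [exists i : 'I_c, [exists h : 'I_3,
         [&& h != lower i, h != upper i, x == (before i, h)
           & y == (after i, h)]]],
      (x == (ord0, cap1 left_end)) && (y == (ord0, cap2 left_end)),
      (x == (ord_max, cap1 right_end)) && (y == (ord_max, cap2 right_end))
    | (x == (ord_max, right_end)) && (y == (ord0, left_end))].

Definition seifert_adjacent : rel point :=
  [rel x y | seifert_arc x y || seifert_arc y x].

(* The Seifert circles are the connected components of the smoothed diagram. *)
Definition nb_seifert_circles : nat := n_comp seifert_adjacent predT.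

Definition nb_viable : nat := #|[set i : 'I_c | viable i]|.

End Diagram.

(* Main.v *)
Require Import Defs.
From mathcomp Require Import all_boot all_fingroup.

(** Cut the diagram by a vertical line.  The closed-up long knot crosses it in
three points, and going from the left end to the right end once means that two
of them are passed rightwards and one leftwards.  So the whole orientation is
recorded by one height per line, that of the leftward strand, and a crossing
is vertically smoothed exactly when the leftward strand takes part in it.

Where that height starts and ends is decided modulo 3.  Turn the picture upside
down after each crossing: in these coordinates a run of length 1 and a run of
length 2 both act on heights as h |-> h + length modulo 3 ([move_flip]), so a
word of length 1 modulo 3 sends height h to h + 1.  It follows that the three
strands are joined into a single knot, and that the leftward strand leaves from
the top height on the left and arrives, on the right, at the height opposite to
the right end ([orientation]).

In the smoothed diagram a horizontally smoothed crossing only lets the three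
heights pass, whereas a vertically smoothed one joins its two heights on each
side, like a cap, and lets the third height pass.  Thus the vertically smoothed
crossings cut the diagram into segments, each closed off by a cap at either
end; the outermost caps are those of the diagram itself.  If the two caps of a
segment join the same two heights, they form a circle, and the third height
continues the long component; if not, the segment is a zigzag that belongs
entirely to the long component.  The leftward strand meets both caps of each
segment, and it lies at an extreme height at both ends of the diagram; hence
the first vertically smoothed crossing is at the height of the left cap and the
last one at the height of the right cap ([right_join0], [left_join_end]).  So
the leftmost segment always gives a circle, the segment after a
vertically smoothed crossing gives one exactly when the crossing is viable
([viableE]), and the long component is one more.

The count is done by a labelling of the points that is constant along the arcs
([label_arc]) and separates the components ([label_conn]). *)

Set Implicit Arguments.
Unset Strict Implicit.
Unset Printing Implicit Defensive.

(** * Components and heights *)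

Lemma n_comp_label (T K : finType) (e : rel T) (f : T -> K) :
    symmetric e -> (forall x y, e x y -> f x = f y) ->
    (forall x y, f x = f y -> connect e x y) ->
  n_comp e predT = #|[set f x | x : T]|.
Proof.
move=> e_sym e_f f_conn; have csym := sym_connect_sym e_sym.
have conn_f x y : connect e x y -> f x = f y.
  case/connectP=> s; elim: s x => [|z s IHs] x /= => [_ -> //|].
  by case/andP=> /e_f -> /IHs H /H.
have -> : [set f x | x : T] = [set f x | x in roots e].
  apply/setP=> k; apply/imsetP/imsetP=> -[x _ ->]; last by exists x.
  exists (root e x); first exact: roots_root.
  exact/conn_f/connect_root.
rewrite card_in_imset => [|x y rx ry /f_conn].
  by apply: eq_card => x; rewrite !inE andbT.
by rewrite -(root_connect csym) (eqP rx) (eqP ry) => /eqP.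
Qed.

Lemma down_ind (n : nat) (P : nat -> Prop) :
  P n -> (forall p, p < n -> P p.+1 -> P p) -> forall p, p <= n -> P p.
Proof.
move=> Pn step p le_pn; rewrite -(subKn le_pn).
have: n - p <= n by exact: leq_subr.
elim: (n - p) => [|m IHm] lt_mn; first by rewrite subn0.
apply: step; first by rewrite ltn_subrL (leq_ltn_trans _ lt_mn).
by rewrite -subSn // subSS; apply/IHm/ltnW.
Qed.

Definition lo (j : 'I_2) : 'I_3 := lift ord_max j.
Definition up (j : 'I_2) : 'I_3 := lift ord0 j.
Definition third (j : 'I_2) : 'I_3 := if j == ord0 then ord_max else ord0.

Lemma ord2P (j : 'I_2) : j = ord0 \/ j = ord_max.
Proof. by case: j => [[|[|//]] ?]; [left | right]; apply: val_inj. Qed.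

Lemma ord3P (h : 'I_3) : [\/ h = ord0, h = lift ord0 ord0 | h = ord_max].
Proof.
by case: h => [[|[|[|//]]] ?];
  [apply: Or31 | apply: Or32 | apply: Or33]; apply: val_inj.
Qed.

Lemma heightP (j : 'I_2) (h : 'I_3) : [\/ h = lo j, h = up j | h = third j].
Proof.
have [->|->] := ord2P j; have [->|->|->] := ord3P h;
  by [apply: Or31; apply: val_inj | apply: Or32; apply: val_inj
     | apply: Or33; apply: val_inj].
Qed.

Lemma lo_up j : (lo j == up j) = false. Proof. by have [->|->] := ord2P j. Qed.
Lemma up_lo j : (up j == lo j) = false. Proof. by have [->|->] := ord2P j. Qed.
Lemma lo_third j : (lo j == third j) = false.
Proof. by have [->|->] := ord2P j. Qed.
Lemma up_third j : (up j == third j) = false.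
Proof. by have [->|->] := ord2P j. Qed.
Lemma third_lo j : (third j == lo j) = false.
Proof. by rewrite eq_sym lo_third. Qed.
Lemma third_up j : (third j == up j) = false.
Proof. by rewrite eq_sym up_third. Qed.
Definition heightE := (lo_up, up_lo, lo_third, up_third, third_lo, third_up).

Lemma tperm_third j : tperm (lo j) (up j) (third j) = third j.
Proof. by rewrite tpermD // heightE. Qed.

Lemma tperm_other j h h' : h != third j -> h' != third j -> h != h' ->
  tperm (lo j) (up j) h = h'.
Proof.
by have [->|->|->] := heightP j h; have [->|->|->] := heightP j h';
  rewrite ?eqxx // ?tpermL ?tpermR.
Qed.

(** An extreme height belongs to only one pair of adjacent heights; a leftward
strand that starts or ends there determines which crossing it can meet. *)
Lemma outer_edge j j' : rev_ord (third j) != third j' -> j' = j.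
Proof. by have [->|->] := ord2P j; have [->|->] := ord2P j'. Qed.

(** Two different caps on three heights make a zigzag through all of them. *)
Lemma two_joins (R : rel 'I_3) j j' :
    reflexive R -> symmetric R -> transitive R ->
    R (lo j) (up j) -> R (lo j') (up j') -> j != j' ->
  forall h h', R h h'.
Proof.
move=> Rr Rs Rt Rj Rj' jj'.
have [R01 R12]: R ord0 (lift ord0 ord0) /\ R (lift ord0 ord0) ord_max.
  have e1 : lo ord0 = ord0 by apply: val_inj.
  have e2 : lo ord_max = up ord0 by apply: val_inj.
  have e3 : up ord_max = ord_max by apply: val_inj.
  move: jj' Rj Rj'; have [->|->] := ord2P j; have [->|->] := ord2P j' => // _;
    by rewrite e1 e2 e3.
have R02 := Rt _ _ _ R01 R12.
by move=> h h'; have [->|->|->] := ord3P h; have [->|->|->] := ord3P h';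
  rewrite ?Rr // Rs.
Qed.

(** * Orientation *)

Section Diagram.

Variable D : diagram.
Notation c := (size D).

Definition idx (k : nat) : 'I_2 := (nth sigma1 D k).1.

Lemma lowerE (i : 'I_c) : lower i = lo (idx i).
Proof. by rewrite /lower /crossing_index (tnth_nth sigma1). Qed.
Lemma upperE (i : 'I_c) : upper i = up (idx i).
Proof. by rewrite /upper /crossing_index (tnth_nth sigma1). Qed.

Definition move (h : 'I_3) (l : letter) : 'I_3 := tperm (lo l.1) (up l.1) h.
(** The height, on line [p], of the strand that leaves the left side at height
[s]. *)
Definition height (p : nat) (s : 'I_3) : 'I_3 := foldl move s (take p D).

Lemma height0 s : height 0 s = s. Proof. by rewrite /height take0. Qed.

Lemma heightS p s : p < c ->
  height p.+1 s = tperm (lo (idx p)) (up (idx p)) (height p s).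
Proof. by move=> lt_pc; rewrite /height (take_nth sigma1) // foldl_rcons. Qed.

Lemma height_inj p : injective (height p).
Proof.
rewrite /height; elim: (take p D) => [|l s IHs] x y //= /IHs; exact: perm_inj.
Qed.

Definition rcap : 'I_2 := if odd c then ord_max else ord0.

Lemma right_endE : right_end D = third rcap.
Proof. by rewrite /right_end /rcap; case: odd. Qed.
Lemma cap1_right : cap1 (right_end D) = lo rcap.
Proof. by rewrite /right_end /rcap; case: odd; apply: val_inj. Qed.
Lemma cap2_right : cap2 (right_end D) = up rcap.
Proof. by rewrite /right_end /rcap; case: odd; apply: val_inj. Qed.
Lemma cap1_left : cap1 left_end = lo ord_max.
Proof. exact: val_inj. Qed.
Lemma cap2_left : cap2 left_end = up ord_max.
Proof. exact: val_inj. Qed.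

(** Lines are numbered by [nat] here so that one can do induction on them. *)
Definition pt (p : nat) (h : 'I_3) : point D := (inord p, h).

Lemma beforeE (i : 'I_c) : before i = inord i.
Proof.
by apply: val_inj; rewrite /= /bump leqNgt ltn_ord inordK // ltnW // ltnS.
Qed.
Lemma afterE (i : 'I_c) : after i = inord i.+1.
Proof. by apply: val_inj; rewrite /= inordK // ltnS. Qed.
Lemma line0E : ord0 = inord 0 :> 'I_c.+1.
Proof. by apply: val_inj; rewrite /= inordK. Qed.
Lemma line_maxE : ord_max = inord c :> 'I_c.+1.
Proof. by apply: val_inj; rewrite /= inordK. Qed.

(* The strands leaving at heights 0, 1 and 2 are passed in the order 0, 2, 1.
   The strand from 0 must end in the right cap, go back along the strand from 2,
   and leave through the strand from 1, which then ends at the right end. *)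
Hypothesis knot_end : height c (lift ord0 ord0) = right_end D.
Hypothesis left_outer : height c ord_max = rev_ord (right_end D).

(** The strand that leaves the left side at the top height is the one followed
leftwards. *)
Definition back p := height p ord_max.

Lemma back_cap : back c != third rcap.
Proof. by rewrite /back left_outer right_endE; case: (ord2P rcap) => ->. Qed.

Lemma travel_right k h : k < c ->
  travel (pt k h, true) = (pt k.+1 (tperm (lo (idx k)) (up (idx k)) h), true).
Proof.
move=> lt_kc; rewrite /travel /=; pose i := Ordinal lt_kc.
have -> : inord k = lift ord_max i by rewrite -[lift _ _]/(before i) beforeE.
by rewrite liftK afterE lowerE upperE.
Qed.

Lemma travel_left k h : k < c ->
  travel (pt k.+1 h, false) = (pt k (tperm (lo (idx k)) (up (idx k)) h), false).
Proof.
move=> lt_kc; rewrite /travel /=; pose i := Ordinal lt_kc.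
have -> : inord k.+1 = lift ord0 i by rewrite -[lift _ _]/(after i) afterE.
by rewrite liftK beforeE lowerE upperE.
Qed.

Lemma travel_max h : travel (pt c h, true) =
  if h == third rcap then (pt 0 ord0, true)
  else (pt c (tperm (lo rcap) (up rcap) h), false).
Proof.
rewrite /travel /= -line_maxE unlift_none cap1_right cap2_right right_endE.
by rewrite /pt -line0E -line_maxE.
Qed.

Lemma travel_min h : travel (pt 0 h, false) =
  if h == third ord_max then (pt c (third rcap), false)
  else (pt 0 (tperm (lo ord_max) (up ord_max) h), true).
Proof.
rewrite /travel /= -line0E unlift_none cap1_left cap2_left right_endE.
by rewrite /pt -line0E -line_maxE.
Qed.

Lemma height_ends : tperm (lo rcap) (up rcap) (height c ord0) = back c.
Proof.
apply: tperm_other back_cap _; last by rewrite (inj_eq (@height_inj _)).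
by rewrite -right_endE -knot_end (inj_eq (@height_inj _)).
Qed.

Lemma left_cap_max : tperm (lo ord_max) (up ord_max) ord_max = lift ord0 ord0.
Proof. by rewrite permE; apply: val_inj. Qed.

Definition oriented (x : state D) : bool := x.2 == (x.1.2 != back x.1.1).

Lemma orientedE p h d : p <= c -> oriented (pt p h, d) = (d == (h != back p)).
Proof. by move=> le_pc; rewrite /oriented /= inordK. Qed.

Lemma ptP (x : point D) : exists p h, p <= c /\ x = pt p h.
Proof. by case: x => p h; exists p, h; rewrite -ltnS /pt inord_val. Qed.

(** Both caps send the leftward strand to a rightward one and conversely, so
travelling never contradicts the orientation read from [back]. *)
Lemma oriented_travel x : oriented x -> oriented (travel x).
Proof.
have back_move k : k < c ->
    back k.+1 = tperm (lo (idx k)) (up (idx k)) (back k).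
  exact: heightS.
case: x => [y d]; have [p [h [le_pc ->]]] := ptP y; rewrite orientedE //.
case: d => [/eqP/esym n_back|/eqP/esym/negbFE/eqP->].
  have [lt_pc | ge_pc] := ltnP p c.
    rewrite travel_right // orientedE // back_move // (inj_eq perm_inj).
    by rewrite n_back.
  have pc : p = c by apply/eqP; rewrite eqn_leq le_pc.
  rewrite pc in n_back *; rewrite travel_max; have [_|n_end] := eqVneq.
    by rewrite orientedE // /back height0.
  by rewrite orientedE // (tperm_other n_end back_cap) ?eqxx.
case: p le_pc => [|k] lt_kc; last first.
  by rewrite travel_left // orientedE 1?ltnW // back_move // tpermK eqxx.
by rewrite travel_min /back height0 orientedE // left_cap_max /back height0.
Qed.

(** The knot is one component: the three strands are all reached, along the
strand from 0, then backwards along the strand from 2, then along the one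
from 1. *)
Lemma reaches_height p (s : 'I_3) : p <= c ->
  fconnect (@travel D) (start D) (pt p (height p s), s != ord_max).
Proof.
have run s' q : q <= c -> fconnect (@travel D) (start D) (pt 0 s', true) ->
    fconnect (@travel D) (start D) (pt q (height q s'), true).
  move=> + start_s'; elim: q => [|q IHq] lt_qc; first by rewrite height0.
  apply: connect_trans (IHq (ltnW lt_qc)) _.
  rewrite heightS // -travel_right //; exact: fconnect1.
have run0 q : q <= c ->
    fconnect (@travel D) (start D) (pt q (height q ord0), true).
  by move=> le_qc; apply: run => //; rewrite /pt -line0E connect0.
have run2 q : q <= c ->
    fconnect (@travel D) (start D) (pt q (back q), false).
  move: q; apply: down_ind => [|k lt_kc IH].
    apply: connect_trans (run0 c (leqnn c)) _.
    suff <- : travel (pt c (height c ord0), true) = (pt c (back c), false).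
      exact: fconnect1.
    rewrite travel_max height_ends ifN // -right_endE -knot_end.
    by rewrite (inj_eq (@height_inj _)).
  apply: connect_trans IH _.
  suff <- : travel (pt k.+1 (back k.+1), false) = (pt k (back k), false).
    exact: fconnect1.
  by rewrite travel_left // /back heightS // tpermK.
move=> le_pc; have [->|->|->] := ord3P s; [exact: run0 | | exact: run2].
apply: run => //; apply: connect_trans (run2 0 isT) _.
suff <- : travel (pt 0 (back 0), false) = (pt 0 (lift ord0 ord0), true).
  exact: fconnect1.
by rewrite travel_min /back height0 left_cap_max.
Qed.

Lemma orientation p h d : p <= c ->
  fconnect (@travel D) (start D) (pt p h, d) = (d == (h != back p)).
Proof.
move=> le_pc; apply/idP/eqP=> [/iter_findex | ->].
  set n := findex _ _ _ => def_x.
  apply/eqP; rewrite -orientedE // -def_x.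
  elim: n {def_x} => [|n IHn] /=; last exact: oriented_travel.
  by rewrite /oriented /= /back height0.
have [g _ gK] : bijective (height p) by apply: injF_bij; apply: height_inj.
by rewrite -(gK h) /back (inj_eq (@height_inj p)); apply: reaches_height.
Qed.

Lemma rightwardsE p h : p <= c -> rightwards (pt p h) = (h != back p).
Proof. by move=> le_pc; rewrite /rightwards orientation //; case: (h == _). Qed.

Lemma leftwardsE p h : p <= c -> leftwards (pt p h) = (h == back p).
Proof. by move=> le_pc; rewrite /leftwards orientation //; case: (h == _). Qed.

(** The leftward strand takes part in crossing [k].  The other strand there is
rightward, so both go up or both go down. *)
Definition vert (k : nat) : bool := back k != third (idx k).

Lemma strand_leftE (i : 'I_c) a :
  strand_left i a = pt i (if a then lo (idx i) else up (idx i)).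
Proof. by rewrite /strand_left beforeE lowerE upperE. Qed.
Lemma strand_rightE (i : 'I_c) a :
  strand_right i a = pt i.+1 (if a then up (idx i) else lo (idx i)).
Proof. by rewrite /strand_right afterE lowerE upperE. Qed.

Lemma vertically_smoothedE (i : 'I_c) : vertically_smoothed i = vert i.
Proof.
rewrite /vertically_smoothed /= /strand_upwards /strand_downwards.
rewrite /strand_leftwards /strand_rightwards !strand_leftE.
rewrite !rightwardsE ?leftwardsE 1?ltnW // /vert.
by have [->|->|->] := heightP (idx i) (back i); rewrite ?heightE ?eqxx.
Qed.

(** * Segments of the smoothed diagram *)

Notation conn := (connect (@seifert_adjacent D)).

Lemma seifert_sym : symmetric (@seifert_adjacent D).
Proof. by move=> x y; exact: orbC. Qed.

Lemma conn_sym : connect_sym (@seifert_adjacent D).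
Proof. exact/sym_connect_sym/seifert_sym. Qed.

Lemma conn_arc x y : seifert_arc x y -> conn x y.
Proof. by move=> xy; apply/connect1/orP; left. Qed.

Lemma conn_crossing (i : 'I_c) a : conn (entry i a) (exit i (~~ a)).
Proof.
apply/conn_arc/orP; left; apply/existsP; exists i; apply/existsP; exists a.
by rewrite !eqxx.
Qed.

Lemma strand_rightwardsE (i : 'I_c) a :
  strand_rightwards i a = ((if a then lo (idx i) else up (idx i)) != back i).
Proof. by rewrite /strand_rightwards strand_leftE rightwardsE // ltnW. Qed.

Lemma conn_third k : k < c ->
  conn (pt k (third (idx k))) (pt k.+1 (third (idx k))).
Proof.
move=> lt_kc; pose i := Ordinal lt_kc.
apply/conn_arc/orP; right; apply/orP; left.
apply/existsP; exists i; apply/existsP; exists (third (idx k)).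
by rewrite lowerE upperE !heightE beforeE afterE !eqxx.
Qed.

Lemma conn_horizontal k h : k < c -> ~~ vert k -> conn (pt k h) (pt k.+1 h).
Proof.
move=> lt_kc; rewrite /vert negbK => /eqP hor; pose i := Ordinal lt_kc.
have := conn_crossing i true; have := conn_crossing i false.
rewrite /entry /exit !strand_rightwardsE !strand_leftE !strand_rightE /=.
rewrite hor !heightE.
by have [->|->|->] := heightP (idx k) h => // _ _; apply: conn_third.
Qed.

Lemma conn_vertical k : k < c -> vert k ->
  conn (pt k (lo (idx k))) (pt k (up (idx k))) /\
  conn (pt k.+1 (lo (idx k))) (pt k.+1 (up (idx k))).
Proof.
move=> lt_kc; rewrite /vert; pose i := Ordinal lt_kc.
have := conn_crossing i true; have := conn_crossing i false.
rewrite /entry /exit !strand_rightwardsE !strand_leftE !strand_rightE /=.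
by have [->|->|->] := heightP (idx k) (back k);
  rewrite ?heightE ?eqxx //= => conn1 conn2 _; split; rewrite // conn_sym.
Qed.

Lemma conn_left_cap : conn (pt 0 (lo ord_max)) (pt 0 (up ord_max)).
Proof.
apply/conn_arc/or3P/Or33/orP; left.
by rewrite cap1_left cap2_left /pt -line0E !eqxx.
Qed.

Lemma conn_right_cap : conn (pt c (lo rcap)) (pt c (up rcap)).
Proof.
apply/conn_arc/or4P/Or44/orP; left.
by rewrite cap1_right cap2_right /pt -line_maxE !eqxx.
Qed.

(** The line on which the segment of line [p] begins. *)
Fixpoint segment (p : nat) : nat :=
  if p is k.+1 then if vert k then p else segment k else 0.
(** The index of the pair of heights joined by the cap that closes the segment
of line [p] on the left: the last vertically smoothed crossing before the line
or, failing that, the left cap of the diagram.  [right_join] is its mirror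
image. *)
Fixpoint left_join (p : nat) : 'I_2 :=
  if p is k.+1 then if vert k then idx k else left_join k else ord_max.
Definition right_join (p : nat) : 'I_2 :=
  head rcap [seq idx k | k <- iota p (c - p) & vert k].

Lemma right_joinS p : p < c ->
  right_join p = if vert p then idx p else right_join p.+1.
Proof. by move=> lt_pc; rewrite /right_join -subnSK //=; case: vert. Qed.

Lemma right_join_end : right_join c = rcap.
Proof. by rewrite /right_join subnn. Qed.

Lemma segment_le p : segment p <= p.
Proof. by elim: p => //= k IHk; case: vert => //; apply: leqW. Qed.

Lemma segmentP p :
  segment p = 0 \/ exists k, [/\ segment p = k.+1, k < p & vert k].
Proof.
elim: p => [|k IHk] /=; first by left.
have [vk|_] := boolP (vert k); first by right; exists k.
case: IHk => [|[m [-> lt_mk vm]]]; first by left.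
by right; exists m; split; rewrite // leqW.
Qed.

Lemma conn_segment p : p <= c ->
  [/\ left_join (segment p) = left_join p,
      right_join (segment p) = right_join p
    & forall h, conn (pt (segment p) h) (pt p h)].
Proof.
elim: p => [//|k IHk] lt_kc /=; have [vk|hk] := boolP (vert k).
  by rewrite /= vk; split.
have [-> -> sk] := IHk (ltnW lt_kc); split=> //.
  by rewrite right_joinS // (negPf hk).
by move=> h; apply: connect_trans (sk h) (conn_horizontal h lt_kc hk).
Qed.

Lemma conn_left_join p : p <= c ->
  conn (pt p (lo (left_join p))) (pt p (up (left_join p))).
Proof.
elim: p => [_|k IHk lt_kc] /=; first exact: conn_left_cap.
have [vk|hk] := boolP (vert k); first by have [] := conn_vertical lt_kc vk.
rewrite (connect_trans _ (conn_horizontal _ lt_kc hk)) // conn_sym.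
apply: connect_trans (conn_horizontal _ lt_kc hk); rewrite conn_sym.
exact/IHk/ltnW.
Qed.

Lemma conn_right_join p : p <= c ->
  conn (pt p (lo (right_join p))) (pt p (up (right_join p))).
Proof.
move: p; apply: down_ind => [|k lt_kc].
  by rewrite right_join_end; exact: conn_right_cap.
rewrite (right_joinS lt_kc); have [vk _|hk IH] := boolP (vert k).
  by have [] := conn_vertical lt_kc vk.
apply: connect_trans (conn_horizontal _ lt_kc hk) _.
by apply: connect_trans IH _; rewrite conn_sym conn_horizontal.
Qed.

(** Horizontally smoothed crossings leave the leftward strand alone, so that it
keeps, throughout a segment, the height that it has at the cap. *)
Lemma back_left_join p : p <= c -> back p != third (left_join p).
Proof.
elim: p => [|k IHk] lt_kc /=; first by rewrite /back height0.
rewrite /back heightS // -/(back k); have [vk|hk] := boolP (vert k).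
  by rewrite -[third _]tperm_third (inj_eq perm_inj).
by rewrite (eqP (negbNE hk)) tperm_third -(eqP (negbNE hk)) IHk // ltnW.
Qed.

Lemma back_right_join p : p <= c -> back p != third (right_join p).
Proof.
move: p; apply: down_ind => [|k lt_kc].
  by rewrite right_join_end back_cap.
rewrite (right_joinS lt_kc); have [vk _|hk] := boolP (vert k); first exact: vk.
by rewrite /back heightS // -/(back k) (eqP (negbNE hk)) tperm_third.
Qed.

Lemma right_join0 : right_join 0 = ord_max.
Proof.
by apply: outer_edge; have := back_right_join (leq0n c); rewrite /back height0.
Qed.

Lemma left_join_end : left_join c = rcap.
Proof.
apply: outer_edge; have := back_left_join (leqnn c).
by rewrite /back left_outer right_endE.
Qed.

(** The two caps of the segment of line [p] form a circle. *)
Definition closed_up p := left_join p == right_join p.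

(** * Counting the components *)

(** A circle is labelled by the line on which its segment begins; [None] is the
label of the long component. *)
Definition label (x : point D) : option 'I_c.+1 :=
  if closed_up x.1 && (x.2 != third (left_join x.1))
  then Some (inord (segment x.1)) else None.

Lemma labelE p h : p <= c -> label (pt p h) =
  if closed_up p && (h != third (left_join p))
  then Some (inord (segment p)) else None.
Proof. by move=> le_pc; rewrite /label /= inordK. Qed.

Lemma label_third k : k < c -> vert k ->
  label (pt k (third (idx k))) = label (pt k.+1 (third (idx k))).
Proof.
move=> lt_kc vk; have le_kc := ltnW lt_kc; rewrite !labelE //.
rewrite /closed_up (right_joinS lt_kc) /= vk eqxx andbF.
by case: eqP => // ->; rewrite eqxx.
Qed.

Lemma label_horizontal k h : k < c -> ~~ vert k ->
  label (pt k h) = label (pt k.+1 h).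
Proof.
move=> lt_kc hk; have le_kc := ltnW lt_kc; rewrite !labelE //.
by rewrite /closed_up (right_joinS lt_kc) /= (negPf hk).
Qed.

Lemma label_left_join p : p <= c ->
  label (pt p (lo (left_join p))) = label (pt p (up (left_join p))).
Proof. by move=> le_pc; rewrite !labelE // !heightE. Qed.

Lemma label_right_join p : p <= c ->
  label (pt p (lo (right_join p))) = label (pt p (up (right_join p))).
Proof.
move=> le_pc; rewrite !labelE // /closed_up.
by case: eqP => // ->; rewrite !heightE.
Qed.

Lemma label_vertical k : k < c -> vert k ->
  label (pt k (lo (idx k))) = label (pt k (up (idx k))) /\
  label (pt k.+1 (lo (idx k))) = label (pt k.+1 (up (idx k))).
Proof.
move=> lt_kc vk.
have := label_right_join (ltnW lt_kc); have := label_left_join lt_kc.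
by rewrite (right_joinS lt_kc) /= vk => -> ->.
Qed.

Lemma label_arc x y : seifert_arc x y -> label x = label y.
Proof.
case/or4P=> [/existsP[i /existsP[a]] | /existsP[i /existsP[h]] | | /orP[]].
- case/andP=> /eqP-> /eqP->; have lt_ic := ltn_ord i.
  rewrite /entry /exit !strand_rightwardsE !strand_leftE !strand_rightE.
  have [vi|hi] := boolP (vert i); last first.
    rewrite (eqP (negbNE hi)).
    by case: a; rewrite !heightE; apply: label_horizontal.
  have [lab_l lab_r] := label_vertical lt_ic vi; move: vi; rewrite /vert.
  by case: a; have [->|->|->] := heightP (idx i) (back i);
    rewrite ?heightE ?eqxx.
- case/and4P=> n_lo n_up /eqP-> /eqP->; rewrite beforeE afterE.
  have [vi|] := boolP (vert i); last exact: label_horizontal.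
  move: n_lo n_up; rewrite lowerE upperE.
  have [->|->|->] := heightP (idx i) h; rewrite ?eqxx // => _ _.
  exact: label_third.
- case/andP=> /eqP-> /eqP->; rewrite cap1_left cap2_left line0E.
  exact: (@label_left_join 0).
- case/andP=> /eqP-> /eqP->; rewrite cap1_right cap2_right line_maxE.
  by rewrite -right_join_end; apply: label_right_join.
case/andP=> /eqP-> /eqP->; rewrite right_endE line0E line_maxE.
by rewrite !labelE // left_join_end /= !eqxx !andbF.
Qed.

Lemma conn_open p h h' : p <= c -> ~~ closed_up p -> conn (pt p h) (pt p h').
Proof.
move=> le_pc open_p; move: h h'.
apply: (two_joins (R := fun h h' => conn (pt p h) (pt p h'))) open_p.
- by move=> h; apply: connect0.
- by move=> h h'; apply: conn_sym.
- by move=> h' h h''; apply: connect_trans.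
- exact: conn_left_join.
exact: conn_right_join.
Qed.

(** Passing a vertically smoothed crossing, the third height is the same on both
sides if the segment before is a circle; otherwise all heights of that segment
belong to the long component. *)
Lemma conn_third_left_join p : p <= c ->
  conn (pt 0 ord0) (pt p (third (left_join p))).
Proof.
elim: p => [_|k IHk lt_kc] /=; first exact: connect0.
apply: connect_trans (IHk (ltnW lt_kc)) _.
have [vk|hk] := boolP (vert k); last exact: conn_horizontal.
apply: connect_trans (conn_third lt_kc).
have [|op] := boolP (closed_up k); last exact/conn_open/op/ltnW.
by rewrite /closed_up right_joinS // vk => /eqP->; apply: connect0.
Qed.

Lemma label_conn x y : label x = label y -> conn x y.
Proof.
have long z : label z = None -> conn (pt 0 ord0) z.
  have [p [h [le_pc ->]]] := ptP z; rewrite labelE //.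
  have base := conn_third_left_join le_pc.
  have [_|op _] := boolP (closed_up p); last first.
    exact: connect_trans base (conn_open _ _ le_pc op).
  by case: eqP => [->|].
have circle z q : label z = Some q -> conn (q, lo (left_join q)) z.
  have [p [h [le_pc ->]]] := ptP z; rewrite labelE //.
  case: ifP => // /andP[_ h_third] [<-].
  have le_sc := leq_trans (segment_le p) le_pc.
  have [e _ seg] := conn_segment le_pc.
  rewrite inordK ?ltnS // e; apply: connect_trans (seg _) _.
  have [e1|e1|e1] := heightP (left_join p) h; rewrite e1 ?connect0 //.
    exact: conn_left_join.
  by rewrite e1 eqxx in h_third.
case ex: (label x) => [q|] /esym ey.
  by apply: connect_trans (circle _ _ ey); rewrite conn_sym circle.
by apply: connect_trans (long _ ey); rewrite conn_sym long.
Qed.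

Lemma label_adjacent x y : seifert_adjacent x y -> label x = label y.
Proof. by case/orP=> /label_arc. Qed.

Lemma right_joinP p : p <= c ->
  right_join p = rcap /\ (forall k, p <= k < c -> ~~ vert k) \/
  exists j, [/\ p <= j < c, vert j, right_join p = idx j
              & forall k, p <= k < j -> ~~ vert k].
Proof.
move: p; apply: down_ind => [|p lt_pc IH].
  left; split=> [|k]; first exact: right_join_end.
  by case/andP=> le_ck /(leq_ltn_trans le_ck); rewrite ltnn.
rewrite right_joinS //; have [vp|hp] := boolP (vert p).
  right; exists p; rewrite leqnn; split=> // k.
  by case/andP=> le_pk /(leq_ltn_trans le_pk); rewrite ltnn.
have extend n : (forall k, p < k < n -> ~~ vert k) ->
    forall k, p <= k < n -> ~~ vert k.
  move=> hor k; rewrite leq_eqVlt => /andP[/predU1P[<- //|lt_pk] lt_kn].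
  by rewrite hor ?lt_pk.
case: IH => [[-> hor]|[j [/andP[lt_pj lt_jc] vj -> hor]]].
  by left; split=> //; apply: extend.
by right; exists j; rewrite (ltnW lt_pj); split=> //; apply: extend.
Qed.

Lemma last_vert_idx i :
    i < c -> vert i -> (forall k, i < k < c -> ~~ vert k) ->
  idx i = rcap.
Proof.
move=> lt_ic vi hor; rewrite -left_join_end.
suff H q : i < q <= c -> left_join q = idx i by rewrite H // lt_ic leqnn.
elim: q => [//|q IHq] /andP[].
rewrite ltnS leq_eqVlt => /predU1P[<- _ /=|lt_iq lt_qc /=].
  by rewrite vi.
by rewrite (negPf (hor q _)) ?lt_iq // IHq // lt_iq ltnW.
Qed.

(** The cap that ends the segment after [i] is the next vertically smoothed
crossing or, if [i] is the last one, the right cap; in the latter case the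
circle closes up because [i] is at the height of the right cap. *)
Lemma viableE (i : 'I_c) : viable i = vert i && closed_up i.+1.
Proof.
rewrite /viable vertically_smoothedE /closed_up /=.
have [vi /=|//] := boolP (vert i).
have same_heightE (j : 'I_c) : same_height i j = (idx i == idx j).
  by rewrite /same_height /crossing_index !(tnth_nth sigma1).
have [[-> hor]|[j [/andP[lt_ij lt_jc] vj -> hor]]] := right_joinP (ltn_ord i).
  rewrite (last_vert_idx (ltn_ord i) vi hor) eqxx; apply/orP; right.
  rewrite /last_vertically_smoothed vertically_smoothedE vi; apply/forallP=> j.
  apply/implyP; rewrite vertically_smoothedE leqNgt; apply: contraL => lt_ij.
  by rewrite hor // lt_ij /=.
pose j' := Ordinal lt_jc.
have next_j : next_vertically_smoothed i j'.
  rewrite /next_vertically_smoothed vertically_smoothedE vj lt_ij.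
  by apply/forallP=> k; apply/implyP; rewrite vertically_smoothedE; apply: hor.
apply/orP/idP=> [[/existsP[k /andP[/and3P[vk lt_ik hor_k]]]|]|eq_ij].
- rewrite same_heightE; suff -> : k = j' by [].
  apply: val_inj; rewrite vertically_smoothedE in vk.
  case: (ltngtP k j) => // [lt_kj|lt_jk].
    by have := hor k; rewrite lt_ik lt_kj vk => /(_ isT).
  have /forallP/(_ j')/implyP := hor_k.
  by rewrite vertically_smoothedE vj lt_ij lt_jk => /(_ isT).
- case/andP=> _ /forallP/(_ j'); rewrite vertically_smoothedE vj /=.
  by rewrite leqNgt lt_ij.
by left; apply/existsP; exists j'; rewrite next_j same_heightE.
Qed.

(** [Some ord0] is the circle at the left cap. *)
Lemma label_image : [set label x | x : point D] =
  None |: (Some ord0 |: [set Some (after i) | i : 'I_c & viable i]).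
Proof.
apply/setP=> k; apply/imsetP/idP => [[x _ ->]|].
  have [p [h [le_pc ->]]] := ptP x; rewrite labelE //.
  case: ifP => [/andP[cl_p _]|_]; last by rewrite !inE.
  have [|[i [e lt_ip vi]]] := segmentP p.
    by move=> ->; rewrite !inE -line0E eqxx.
  have lt_ic := leq_trans lt_ip le_pc.
  rewrite !inE e; apply/or3P/Or33/imsetP; exists (Ordinal lt_ic).
    rewrite inE viableE /= vi /closed_up -e.
    by have [-> ->] := conn_segment le_pc.
  by rewrite afterE.
rewrite !inE => /or3P[/eqP->|/eqP->|/imsetP[i]].
- by exists (pt 0 ord0); rewrite // labelE //= andbF.
- exists (pt 0 ord_max) => //.
  by rewrite labelE // /closed_up right_join0 /= line0E.
rewrite inE viableE => /andP[vi cl_i] ->; exists (pt i.+1 (lo (idx i))) => //.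
by rewrite labelE // cl_i /= vi heightE afterE.
Qed.

Lemma nb_seifert_circles_knot : nb_seifert_circles D = nb_viable D + 2.
Proof.
rewrite /nb_seifert_circles.
rewrite (n_comp_label seifert_sym label_adjacent label_conn) label_image.
rewrite !cardsU1 card_imset; last by move=> i j /Some_inj; apply: lift_inj.
set V := [set Some _ | _ in _].
have nV_None : None \notin V by apply/imsetP=> -[].
have nV_0 : Some ord0 \notin V by apply/imsetP=> -[].
by rewrite !inE (negPf nV_None) nV_0 addn2.
Qed.

End Diagram.

(** * Billiard words *)

Lemma runs_word_of_runs b eps : all (leq 1) eps ->
  runs (word_of_runs b eps) =
  if eps is e :: eps' then (b, e) :: runs (word_of_runs (~~ b) eps') else [::].
Proof.
have runs_cons s n r w' :
    runs w' = (s, n) :: r -> runs (s :: w') = (s, n.+1) :: r.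
  by move=> /= ->; rewrite eqxx.
elim: eps b => [//|e eps IHeps] b /andP[e_gt0 /IHeps {}IHeps].
case: e e_gt0 => // e _; elim: e => [|e IHe]; last exact: runs_cons IHe.
by rewrite /= IHeps; case: eps {IHeps} => [|e' eps] //=; case: b.
Qed.

(** Heights in the picture turned upside down after each crossing; the sign [b]
of the next run tells whether the number of crossings passed is even. *)
Definition flip (b : bool) (h : 'I_3) : 'I_3 := if b then h else rev_ord h.

(** In flipped coordinates a run of length 1 swaps 0 and 1 and one of length 2
swaps 1 and 2, whatever their sign.  Followed by the reflection h |-> 2 - h,
these are the rotations h |-> h + 1 and h |-> h + 2 of the integers modulo 3. *)
Lemma move_flip b e h : e = 1 \/ e = 2 ->
  flip (~~ b) (move (flip b h) (crossing_of_run (b, e))) = inord ((h + e) %% 3).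
Proof.
by case=> ->; case: b; have [->|->|->] := ord3P h;
  rewrite /move permE; apply: val_inj; rewrite /= inordK.
Qed.

Lemma flipK b : involutive (flip b).
Proof. by case: b => //; apply: rev_ordK. Qed.

Lemma move_word b eps h : (forall e, e \in eps -> e = 1 \/ e = 2) ->
  foldl move (flip b h) (alternating_diagram (word_of_runs b eps)) =
  flip (b (+) odd (size eps)) (inord ((h + sumn eps) %% 3)).
Proof.
rewrite /alternating_diagram; elim: eps b h => [|e eps IHeps] b h eps12.
  by rewrite /= addbF addn0 modn_small // inord_val.
have eps_gt0 : all (leq 1) (e :: eps) by apply/allP=> e' /eps12[] ->.
have e12 : e = 1 \/ e = 2 by apply: eps12; rewrite mem_head.
have {}eps12 e' : e' \in eps -> e' = 1 \/ e' = 2.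
  by move=> e'_eps; apply: eps12; rewrite inE e'_eps orbT.
rewrite (runs_word_of_runs _ eps_gt0) /=.
rewrite -[move _ _](flipK (~~ b)) (move_flip _ _ e12) IHeps //.
by rewrite inordK ?ltn_mod // modnDml addnA addNb addbN.
Qed.

Lemma size_alternating_diagram b eps :
    (forall e, e \in eps -> e = 1 \/ e = 2) ->
  size (alternating_diagram (word_of_runs b eps)) = size eps.
Proof.
rewrite size_map; elim: eps b => [|e eps IHeps] b eps12 //.
have eps_gt0 : all (leq 1) (e :: eps) by apply/allP=> e' /eps12[] ->.
rewrite (runs_word_of_runs _ eps_gt0) /=.
by rewrite IHeps // => e' e'_eps; apply: eps12; rewrite inE e'_eps orbT.
Qed.

Theorem theorem3p5 : forall (c : nat) (w : word),
  3 <= c -> billiard_word c w ->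
  nb_seifert_circles (alternating_diagram w)
  = nb_viable (alternating_diagram w) + 2.
Proof.
move=> c w _ [eps [_ _ eps12 sum1 ->]].
have end_height h : foldl move h (alternating_diagram (word_of_runs true eps)) =
    flip (~~ odd (size eps)) (inord ((h + 1) %% 3)).
  by rewrite -modnDmr -sum1 modnDmr -(move_word true h eps12).
apply: nb_seifert_circles_knot; rewrite /height take_size end_height;
  rewrite /right_end size_alternating_diagram //;
  by case: odd; apply: val_inj; rewrite /= inordK.
Qed.
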